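(* For any $p\ge1$, for any $n\times n$ nonnegative matrix $A$, $$\mathrm{perm}(A)\le\max\Big\{1,\frac{n!}{n^{n/p}}\Big\}\prod_{i=1}^n\|R_i\|_p,$$ where $R_i$ denotes the $i$-th row of $A$ and $\|\cdot\|_p$ denotes the $\ell_p$-norm of a vector, and equality is uniquely achieved at either the identity matrix or the all-$1$ matrix (up to permutation of rows and multiplication by a scalar).
   Context: For an $n\times n$ matrix $A=(a_{i,j})$, the permanent of $A$ is $\mathrm{perm}(A)=\sum_{\sigma\in\mathcal S_n}\prod_{i=1}^n a_{i,\sigma_i}$, where $\mathcal S_n$ is the symmetric group of permutations of $\{1,\dots,n\}$. A nonnegative matrix is a matrix with nonnegative real entries.
   Formalization: Uniqueness of equality is claimed only for A without zero rows and (n,p)≠(2,2), with a positive scalar for each row rather than one scalar; otherwise it fails: a zero row makes both sides 0, [[1,2],[2,1]] gives equality at n=p=2, and diag(1,2) gives equality at p=1. *)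

(* Defs.v *)
From mathcomp Require Import all_boot all_order all_fingroup all_algebra.
From mathcomp Require Import all_classical all_reals all_analysis.

Set Implicit Arguments.
Unset Strict Implicit.
Unset Printing Implicit Defensive.

Import Order.TTheory GRing.Theory Num.Theory.

Local Open Scope ring_scope.

Definition permanent (R : comNzRingType) (n : nat) (A : 'M[R]_n) : R :=
  \sum_(s : 'S_n) \prod_(i < n) A i (s i).

Definition lpnorm (R : realType) (n : nat) (p : R) (x : 'rV[R]_n) : R :=
  (\sum_(j < n) `|x 0 j| `^ p) `^ p^-1.

(* Both sides of the inequality are homogeneous in each row separately, so each
   row carries its own positive scalar. *)
Definition row_perm_scale_equiv (R : realType) (n : nat) (A B : 'M[R]_n) : Prop :=
  exists (s : 'S_n) (c : 'I_n -> R),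
    (forall i, 0 < c i) /\ (forall i, row i A = c i *: row (s i) B).

(* Main.v *)
(* Let mu be the law on permutations with mu(s) proportional to prod_i A i (s i), and let q_i be
   the law of s(i).  Revealing the rows in a random order and excluding the columns already
   taken bounds the entropy of mu by the sum over the rows of
     phi(q) = H(q) + E_S [log q(S_j)],
   where j has law q and S_j is the set of columns that do not come after j in a uniform random
   order.  With Gibbs' inequality for each row, everything reduces to
     phi(q) <= (ln n! / (n ln n)) H(q),
   an equality for Dirac and for uniform q.

   For V_t = n!/t times the average of q(S) ln q(S) over sets S of size t, this follows
   once (V_t - V_1) / ln t is nondecreasing in t, and averaging over S turns each step into an
   inequality on t weights of sum 1:
     sum_i L(1 - q_i) <= K sum_i L(q_i),  L(x) = x ln x,  K = (t-1) ln(t/(t-1)) / ln t.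
   The function K L(x) - L(1-x) is convex and then concave, so the extreme case has all weights
   but one equal, and a function of one variable remains. *)

Require Import Defs.
From mathcomp Require Import all_boot all_order all_fingroup all_algebra.
From mathcomp Require Import all_classical all_reals all_analysis.
From mathcomp Require Import ring lra.

Set Implicit Arguments.
Unset Strict Implicit.
Unset Printing Implicit Defensive.

Import Order.TTheory GRing.Theory Num.Theory.

Local Open Scope ring_scope.

(** * The logarithm and x ln x: derivatives and tangent bounds *)

Lemma mean_value (R : realType) (f df : R -> R) (a b : R) :
  a < b -> (forall x, a <= x <= b -> is_derive x 1 f (df x)) ->
  exists2 c, a < c < b & f b - f a = df c * (b - a).
Proof.
move=> ab fdf; have [||c] := @MVT R f df a b ab.
- by move=> x; rewrite in_itv /= => /andP[/ltW ax /ltW xb]; apply: fdf; rewrite ax.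
- apply: derivable_within_continuous => x; rewrite in_itv /= => /fdf.
  by case.
by rewrite in_itv /=; exists c.
Qed.

Lemma ln_le_subr1 (R : realType) (x : R) : 0 < x -> ln x <= x - 1.
Proof. by move=> x0; rewrite -{1}(subrKC 1 x) le_ln1Dx ?ltrBrDl ?subrr // addrC subrr. Qed.

(** Strictness comes from the square root: with x = s^2, ln x = 2 ln s <= 2 (s - 1), and x - 1
    exceeds this by (s - 1)^2. *)
Lemma ln_lt_subr1 (R : realType) (x : R) : 0 < x -> x != 1 -> ln x < x - 1.
Proof.
move=> x0 x1; have s0 : 0 < Num.sqrt x by rewrite sqrtr_gt0.
have := ln_le_subr1 s0; set s := Num.sqrt x in s0 *.
have xs : x = s ^+ 2 by rewrite sqr_sqrtr // ltW.
have s1 : s != 1 by apply: contra x1 => /eqP s1; rewrite xs s1 expr1n.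
rewrite xs lnXn // => le; rewrite -mulr_natl.
have : 0 < (s - 1) ^+ 2 by rewrite exprn_even_gt0 //= subr_eq0.
nra.
Qed.

Definition xlnx (R : realType) (x : R) : R := x * ln x.

Lemma xlnx0 (R : realType) : xlnx (0 : R) = 0.
Proof. by rewrite /xlnx mul0r. Qed.

Lemma xlnx1 (R : realType) : xlnx (1 : R) = 0.
Proof. by rewrite /xlnx ln1 mulr0. Qed.

Lemma xlnxM (R : realType) (x y : R) : 0 < x -> 0 <= y ->
  xlnx (x * y) = x * xlnx y + y * xlnx x.
Proof.
move=> x0; rewrite le_eqVlt => /predU1P[<-|y0]; first by rewrite mulr0 xlnx0; ring.
by rewrite /xlnx lnM ?posrE //; ring.
Qed.

Lemma is_derive_xlnx (R : realType) (x : R) :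
  0 < x -> is_derive x 1 (@xlnx R) (ln x + 1).
Proof.
move=> x0; have dl := is_derive1_ln x0.
rewrite /xlnx; apply: is_derive_eq.
by rewrite /GRing.scale /= mulr1 divff ?gt_eqF // addrC; ring.
Qed.

Lemma is_derive_xlnx_affine (R : realType) (a b x : R) : 0 < a + b * x ->
  is_derive x 1 (fun y => xlnx (a + b * y)) (b * (ln (a + b * x) + 1)).
Proof.
move=> x0; have dl := is_derive_xlnx x0.
have da : is_derive x 1 (fun y : R => a + b * y) b.
  by apply: is_derive_eq; rewrite /GRing.scale /=; ring.
have := is_derive1_comp (f := @xlnx R) (g := fun y => a + b * y) dl da.
by rewrite mulrC.
Qed.
Lemma is_derive_ln_affine (R : realType) (a b x : R) : 0 < a + b * x ->
  is_derive x 1 (fun y => ln (a + b * y)) (b / (a + b * x)).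
Proof.
move=> x0; have dl := is_derive1_ln x0.
have da : is_derive x 1 (fun y : R => a + b * y) b.
  by apply: is_derive_eq; rewrite /GRing.scale /=; ring.
have := is_derive1_comp (f := @ln R) (g := fun y => a + b * y) dl da.
by rewrite mulrC.
Qed.

(** From ln z < z - 1 at z = y/x and at z = x/y. *)
Lemma ln_diff_bounds (R : realType) (x y : R) : 0 < x -> x < y ->
  (y - x) / y < ln y - ln x < (y - x) / x.
Proof.
move=> x0 xy; have y0 := lt_trans x0 xy.
have yx : y / x != 1 by rewrite gt_eqF // ltr_pdivlMr // mul1r.
have xy1 : x / y != 1 by rewrite lt_eqF // ltr_pdivrMr // mul1r.
have := ln_lt_subr1 (divr_gt0 y0 x0) yx; have := ln_lt_subr1 (divr_gt0 x0 y0) xy1.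
rewrite !ln_div ?posrE // !mulrBl !divff ?gt_eqF //; lra.
Qed.

(** * The inequality on weights of sum 1 *)

(** The contribution K L(x) - L(1 - x) of one weight. Its second derivative K/x - 1/(1 - x) changes
    sign at K/(1 + K). *)
Definition gap (R : realType) (K x : R) : R := K * xlnx x - xlnx (1 - x).
Definition dgap (R : realType) (K x : R) : R := K * (ln x + 1) + (ln (1 - x) + 1).

Lemma gap0 (R : realType) (K : R) : gap K 0 = 0.
Proof. by rewrite /gap subr0 xlnx0 xlnx1; ring. Qed.

Lemma gap1 (R : realType) (K : R) : gap K 1 = 0.
Proof. by rewrite /gap subrr xlnx0 xlnx1; ring. Qed.

Lemma is_derive_gap (R : realType) (K x : R) :
  0 < x < 1 -> is_derive x 1 (gap K) (dgap K x).
Proof.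
move=> /andP[x0 x1]; have d1 := is_derive_xlnx x0.
have x1' : 0 < 1 + -1 * x by lra.
have d2 := is_derive_xlnx_affine x1'.
rewrite (_ : gap K = (fun y => K * xlnx y - xlnx (1 + -1 * y))).
  apply: is_derive_eq; rewrite /dgap /GRing.scale /=.
  by rewrite (_ : 1 + -1 * x = 1 - x); ring.
by apply/funext => y; rewrite /gap mulN1r.
Qed.

(** Convex side, up to K/(1 + K): K times the lower bound (y - x)/y for ln y - ln x is at least the
    upper bound (y - x)/(1 - y) for ln (1 - x) - ln (1 - y). *)
Lemma dgap_incr (R : realType) (K x y : R) : 0 < K -> 0 < x -> x < y ->
  (1 + K) * y <= K -> dgap K x < dgap K y.
Proof.
move=> K0 x0 xy yK; have y1 : y < 1 by nra.
have /andP[l1 _] := ln_diff_bounds x0 xy.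
have y1' : 0 < 1 - y by lra.
have yx1 : 1 - y < 1 - x by lra.
have /andP[_ l2] := ln_diff_bounds y1' yx1.
rewrite /dgap.
have y0 := lt_trans x0 xy.
have : (y - x) / (1 - y) <= K * ((y - x) / y).
  rewrite ler_pdivrMr ?subr_gt0 // -subr_ge0.
  have -> : K * ((y - x) / y) * (1 - y) - (y - x) = (y - x) * (K - (1 + K) * y) / y.
    by field; rewrite gt_eqF.
  by rewrite divr_ge0 ?mulr_ge0 ?subr_ge0 // ltW.
rewrite (_ : 1 - x - (1 - y) = y - x) in l2; last by ring.
by have := ltr_pM2l K0 ((y - x) / y) (ln y - ln x); rewrite l1; lra.
Qed.

Lemma dgap_decr (R : realType) (K x y : R) : 0 < K -> 0 < x -> x < y -> y < 1 ->
  K <= (1 + K) * x -> dgap K y < dgap K x.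
Proof.
move=> K0 x0 xy y1 xK; have x1 := lt_trans xy y1.
have /andP[_ l1] := ln_diff_bounds x0 xy.
have y1' : 0 < 1 - y by lra.
have yx1 : 1 - y < 1 - x by lra.
have /andP[l2 _] := ln_diff_bounds y1' yx1.
rewrite /dgap.
have : K * ((y - x) / x) <= (y - x) / (1 - x).
  rewrite ler_pdivlMr ?subr_gt0 // -subr_ge0.
  have -> : y - x - K * ((y - x) / x) * (1 - x) = (y - x) * ((1 + K) * x - K) / x.
    by field; rewrite gt_eqF.
  by rewrite divr_ge0 ?mulr_ge0 ?subr_ge0 // ltW.
rewrite (_ : 1 - x - (1 - y) = y - x) in l2; last by ring.
by have := ltr_pM2l K0 (ln y - ln x) ((y - x) / x); rewrite l1; lra.
Qed.

Lemma gap_tangent (R : realType) (K t x : R) : 0 < K -> 0 < t -> (1 + K) * t <= K ->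
  0 <= x -> (1 + K) * x <= K -> gap K t + dgap K t * (x - t) <= gap K x.
Proof.
move=> K0 t0 tK; have t1 : t < 1 by nra.
rewrite le_eqVlt => /predU1P[<- _|x0 xK].
  (* [gap] has no derivative at 0. There the claim is - ln (1 - t) <= (1 + K) t, which follows from
     - ln (1 - t) <= t/(1 - t) and 1/(1 - t) <= 1 + K. *)
  rewrite gap0 /gap /dgap /xlnx.
  suff : - ln (1 - t) <= (1 + K) * t by lra.
  have t1' : 0 < 1 - t by lra.
  have t2 : 1 - t < 1 by lra.
  have /andP[_] := ln_diff_bounds t1' t2.
  rewrite ln1 sub0r subKr => /ltW /le_trans; apply.
  rewrite ler_pdivrMr ?subr_gt0 //; nra.
have x1 : x < 1 by nra.
have [xt|tx|->] := ltgtP x t; last by rewrite subrr mulr0 addr0.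
- have [||c /andP[xc ct] e] := @mean_value R (gap K) (dgap K) x t => //.
    by move=> y /andP[xy yt]; apply: is_derive_gap; apply/andP; split; lra.
  have : dgap K c < dgap K t by apply: dgap_incr => //; lra.
  by nra.
- have [||c /andP[tc cx] e] := @mean_value R (gap K) (dgap K) t x => //.
    by move=> y /andP[xy yt]; apply: is_derive_gap; apply/andP; split; lra.
  have : dgap K t < dgap K c by apply: dgap_incr => //; nra.
  by nra.
Qed.

(** Strict concavity beyond K/(1 + K): moving two points apart with their sum fixed lowers the
    total. It serves to push the smaller of two large weights down to K/(1 + K). *)
Lemma gap_spread (R : realType) (K x a b : R) : 0 < K -> 0 < x -> K <= (1 + K) * x ->
  x < b -> b <= a -> a + b <= 1 -> gap K (a + b - x) + gap K x < gap K a + gap K b.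
Proof.
move=> K0 x0 xK xb ba ab1.
have [||c /andP[xc cb] ec] := @mean_value R (gap K) (dgap K) x b => //.
  by move=> y /andP[xy yt]; apply: is_derive_gap; apply/andP; split; lra.
have [||d /andP[ad dab] ed] := @mean_value R (gap K) (dgap K) a (a + b - x); first by lra.
  by move=> y /andP[xy yt]; apply: is_derive_gap; apply/andP; split; lra.
have : dgap K d < dgap K c by apply: dgap_decr => //; nra.
by rewrite (_ : a + b - x - a = b - x) in ed; [nra | ring].
Qed.

(* The value of the sum of gaps when one weight is 1 - z and the m others are equal. *)
Definition spike (R : realType) (K m z : R) : R := gap K (1 - z) + m * gap K (z / m).
Definition dspike (R : realType) (K m z : R) : R := dgap K (z / m) - dgap K (1 - z).

Lemma is_derive_spike (R : realType) (K m z : R) : 1 <= m -> 0 < z < 1 ->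
  is_derive z 1 (spike K m) (dspike K m z).
Proof.
move=> m1 /andP[z0 z1]; have m0 : 0 < m by lra.
have d1 : is_derive (1 - z) 1 (gap K) (dgap K (1 - z)).
  by apply: is_derive_gap; apply/andP; split; lra.
have d2 : is_derive (z / m) 1 (gap K) (dgap K (z / m)).
  apply: is_derive_gap; rewrite divr_gt0 //= ltr_pdivrMr //; lra.
have e1 : is_derive z 1 (fun y : R => 1 - y) (-1).
  by apply: is_derive_eq; rewrite /GRing.scale /=; ring.
have e2 : is_derive z 1 (fun y : R => y / m) m^-1.
  by apply: is_derive_eq; rewrite /GRing.scale /=; ring.
have f1 := is_derive1_comp (f := gap K) (g := fun y : R => 1 - y) d1 e1.
have f2 := is_derive1_comp (f := gap K) (g := fun y : R => y / m) d2 e2.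
rewrite (_ : spike K m = fun y => (gap K \o (fun y : R => 1 - y)) y
   + m * (gap K \o (fun y : R => y / m)) y) //.
apply: is_derive_eq; rewrite /dspike /GRing.scale /=.
by field; rewrite gt_eqF.
Qed.

Lemma dspikeE (R : realType) (K m z : R) : 0 < m -> 0 < z ->
  dspike K m z = ln (1 - z / m) + (K - 1) * ln z - K * ln (1 - z) - K * ln m.
Proof.
move=> m0 z0; rewrite /dspike /dgap subKr ln_div ?posrE //; ring.
Qed.

(** The numerator of this second derivative is affine in z, so [spike] has a single inflection, at z
    = (1 - K) m / (m - K). *)
Lemma is_derive_dspike (R : realType) (K m z : R) : 1 <= m -> 0 < z < 1 ->
  is_derive z 1 (dspike K m)
    (((m - K) * z - (1 - K) * m) / (z * (1 - z) * (m - z))).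
Proof.
move=> m1 /andP[z0 z1]; have m0 : 0 < m by lra.
have p1 : 0 < 1 + - m^-1 * z.
  by rewrite mulNr subr_gt0 mulrC ltr_pdivrMr //; lra.
have p2 : 0 < 1 + - 1 * z by lra.
have p3 : 0 < 0 + m^-1 * z by rewrite add0r mulr_gt0 ?invr_gt0.
have d1 := is_derive_ln_affine p1.
have d2 := is_derive_ln_affine p2.
have d3 := is_derive_ln_affine p3.
have d4 := is_derive1_ln z0.
rewrite (_ : dspike K m = fun y => K * ln (0 + m^-1 * y) + ln (1 + - m^-1 * y)
   - (K * ln (1 + -1 * y) + ln y)).
  apply: is_derive_eq; rewrite /GRing.scale /=.
  by field; rewrite !gt_eqF ?subr_gt0 //=; lra.
apply/funext => y; rewrite /dspike /dgap subKr add0r mulN1r mulNr [m^-1 * y]mulrC.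
ring.
Qed.

(** The bracket is the value at 0 of the tangent to [spike] at z. *)
Lemma spike_intercept (R : realType) (K m z : R) : 0 < m -> 0 < z ->
  spike K m z = z * dspike K m z + (K * ln (1 - z) - m * ln (1 - z / m)).
Proof.
move=> m0 z0; rewrite dspikeE // /spike /gap /xlnx subKr ln_div ?posrE //.
by field; rewrite gt_eqF.
Qed.

(** On the concave range of [spike] the tangent passes above the value 0 at 0. The expression is 0
    at z = 0, and its derivative has the sign of (1 - K) m - (m - K) z. *)
Lemma spike_intercept_gt0 (R : realType) (K m z : R) : K < 1 -> 1 <= m ->
  0 < z < 1 -> (m - K) * z <= (1 - K) * m -> 0 < K * ln (1 - z) - m * ln (1 - z / m).
Proof.
move=> K1 m1 /andP[z0 z1] zK; have m0 : 0 < m by lra.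
pose f y := K * ln (1 + -1 * y) - m * ln (1 + - m^-1 * y).
pose df y := K * (-1 / (1 + -1 * y)) - m * (- m^-1 / (1 + - m^-1 * y)).
have [|c /andP[c0 cz]] := @mean_value R f df 0 z z0.
  move=> y /andP[y0 yz].
  have p1 : 0 < 1 + -1 * y by lra.
  have p2 : 0 < 1 + - m^-1 * y.
    by rewrite mulNr subr_gt0 mulrC ltr_pdivrMr //; lra.
  have d1 := is_derive_ln_affine p1.
  have d2 := is_derive_ln_affine p2.
  by rewrite /f /df; apply: is_derive_eq; rewrite /GRing.scale /=; ring.
rewrite /f !mulr0 !addr0 ln1 !mulr0 !subr0 mulN1r mulNr [m^-1 * z]mulrC => ->.
rewrite mulr_gt0 //.
have -> : df c = ((1 - K) * m - (m - K) * c) / ((1 - c) * (m - c)).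
  by rewrite /df; field; rewrite !gt_eqF ?subr_gt0 //=; lra.
rewrite divr_gt0 ?mulr_gt0 ?subr_gt0 //; try lra.
by apply: lt_le_trans zK; rewrite ltr_pM2l //; lra.
Qed.

(* [spike] is concave and then convex on [0, m/(m+1)], with a double zero at m/(m+1). *)
Lemma spike_gt0 (R : realType) (K m z : R) : K < 1 -> 1 < K * m -> 1 < m ->
  gap K (m + 1)^-1 = 0 -> 0 < z -> z * (m + 1) < m -> 0 < spike K m z.
Proof.
move=> K1 Km m1 gK; have m0 : 0 < m by lra.
have K0 : 0 < K by nra.
have mK : 0 < m - K by lra.
(* At w all m + 1 weights are equal; v is the inflection. K < 1 gives 0 < v, and 1 < K m is exactly
   v < w. *)
pose w := m / (m + 1); pose v := (1 - K) * m / (m - K).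
have wE : w * (m + 1) = m by rewrite /w; field; rewrite gt_eqF //; lra.
have vE : (m - K) * v = (1 - K) * m by rewrite /v; field; rewrite gt_eqF.
have w1 : w < 1 by nra.
have w0 : 0 < w by rewrite divr_gt0 //; lra.
have v0 : 0 < v by rewrite divr_gt0 ?mulr_gt0 //; lra.
have vw : v < w.
  rewrite -(ltr_pM2l mK) vE /w mulrA ltr_pdivlMr; last by lra.
  nra.
have dw : dspike K m w = 0.
  rewrite /dspike; have -> : w / m = 1 - w by rewrite /w; field; rewrite !gt_eqF //; lra.
  by rewrite subrr.
have sw : spike K m w = 0.
  rewrite /spike; have -> : w / m = (m + 1)^-1 by rewrite /w; field; rewrite !gt_eqF //; lra.
  have -> : 1 - w = (m + 1)^-1 by rewrite /w; field; rewrite !gt_eqF //; lra.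
  by rewrite gK; ring.
(* Convex range: the slope increases to 0 at w, so it is negative before w, and [spike] decreases to
   0. *)
have right y : v <= y -> y < w -> 0 < spike K m y.
  move=> vy yw.
  have [||c /andP[yc cw] e] := @mean_value R (spike K m) (dspike K m) y w => //.
    by move=> x /andP[yx xw]; apply: is_derive_spike; [lra | apply/andP; split; lra].
  have [||d /andP[cd dw' ] e'] := @mean_value R (dspike K m)
     (fun z => ((m - K) * z - (1 - K) * m) / (z * (1 - z) * (m - z))) c w => //.
    by move=> x /andP[yx xw]; apply: is_derive_dspike; [lra | apply/andP; split; lra].
  have : 0 < ((m - K) * d - (1 - K) * m) / (d * (1 - d) * (m - d)).
    rewrite divr_gt0 ?mulr_gt0 ?subr_gt0 //; try lra.
    by rewrite -vE ltr_pM2l //; lra.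
  move: e e'; rewrite sw dw; set D := _ / _ => e e' D0.
  have : dspike K m c < 0 by nra.
  nra.
move=> z0 zm; have zw : z < w by rewrite /w ltr_pdivlMr //; lra.
have [vz|zv] := leP v z; first exact: right.
have zK : (m - K) * z <= (1 - K) * m by rewrite -vE ler_pM2l // ltW.
(* Concave range: a nonnegative slope is settled by the intercept of the tangent. A negative slope
   stays negative up to v, where [right] applies. *)
have [dz|dz] := leP 0 (dspike K m z).
  rewrite spike_intercept // ltr_wpDl ?mulr_ge0 // ?(ltW z0) //.
  by apply: spike_intercept_gt0 => //; [lra | apply/andP; split; lra].
apply: (lt_trans (right v (lexx _) vw)).
have [||c /andP[zc cv] e] := @mean_value R (spike K m) (dspike K m) z v => //.
  by move=> x /andP[yx xw]; apply: is_derive_spike; [lra | apply/andP; split; lra].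
have [||d /andP[zd dc] e'] := @mean_value R (dspike K m)
   (fun z => ((m - K) * z - (1 - K) * m) / (z * (1 - z) * (m - z))) z c => //.
  by move=> x /andP[yx xw]; apply: is_derive_dspike; [lra | apply/andP; split; lra].
have : ((m - K) * d - (1 - K) * m) / (d * (1 - d) * (m - d)) < 0.
  rewrite -oppr_gt0 -mulNr divr_gt0 ?mulr_gt0 ?subr_gt0 //; try lra.
  by rewrite opprB subr_gt0 -vE ltr_pM2l //; lra.
move: e e'; set D := _ / _ => e e' D0.
have : dspike K m c < 0 by nra.
nra.
Qed.

(** Induction on the number of weights above the inflection x0 = K/(1 + K). While two remain,
    spreading them strictly lowers the sum. Once only the largest can exceed x0, replacing the
    others by their mean gives [spike] as a lower bound. *)
Lemma sum_gap_ge0 (R : realType) (I : finType) (U : {set I}) (q : I -> R) (m : nat) (K : R) :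
    #|U| = m.+1 -> (1 < m)%N -> K < 1 -> 1 < K * m%:R -> gap K m.+1%:R^-1 = 0 ->
    {in U, forall i, 0 <= q i} -> \sum_(i in U) q i = 1 ->
  0 <= \sum_(i in U) gap K (q i) /\
  (\sum_(i in U) gap K (q i) = 0 ->
    (exists2 i, i \in U & q i = 1) \/ {in U, forall i, q i = m.+1%:R^-1}).
Proof.
move=> cU m1 K1 Km gK; have m1R : 1 < m%:R :> R by rewrite ltr1n.
have K0 : 0 < K by nra.
pose x0 := K / (1 + K).
have xK : (1 + K) * x0 = K by rewrite /x0; field; rewrite gt_eqF //; lra.
have x00 : 0 < x0 by rewrite divr_gt0 //; lra.
have below a : a <= x0 -> (1 + K) * a <= K.
  by move=> ax; rewrite -[X in _ <= X]xK ler_pM2l //; lra.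
have [N] := ubnP #|[set i in U | x0 < q i]|.
elim: N q => // N IHN q; rewrite ltnS => cN q0 q1.
have [/existsP[i /existsP[j /and5P[iU jU ij xj ji]]]|] := boolP [exists i, [exists j,
  [&& i \in U, j \in U, i != j, x0 < q j & q j <= q i]]].
  have jUi : j \in U :\ i by rewrite in_setD1 eq_sym ij.
  have split2 (f : I -> R) : \sum_(k in U) f k = f i + (f j + \sum_(k in U :\ i :\ j) f k).
    by rewrite (big_setD1 i) //= (big_setD1 j).
  (* The smaller weight drops to x0 and the larger one takes the excess, so one index fewer lies
     above x0. *)
  pose q' k := if k == i then q i + q j - x0 else if k == j then x0 else q k.
  have q'i : q' i = q i + q j - x0 by rewrite /q' eqxx.
  have q'j : q' j = x0 by rewrite /q' eq_sym (negPf ij) eqxx.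
  have q'k k : k \in U :\ i :\ j -> q' k = q k.
    by rewrite !in_setD1 /q' => /and3P[/negPf-> /negPf->].
  have rest_ge0 : 0 <= \sum_(k in U :\ i :\ j) q k.
    by apply: sumr_ge0 => k; rewrite !in_setD1 => /and3P[_ _ kU]; exact: q0.
  have le1 : q i + q j <= 1.
    by rewrite -q1 split2; lra.
  have [||| ge0 _] := IHN q'.
  - apply: leq_trans cN; apply: proper_card; apply/properP; split.
      apply/fintype.subsetP => k; rewrite !inE /q' => /andP[-> /=].
      have [->|_] := eqVneq k i; first by move=> _; exact: (lt_le_trans xj).
      by have [->|_] := eqVneq k j.
    by exists j; rewrite inE jU //= q'j ltxx.
  - move=> k kU; rewrite /q'; have [_|_] := eqVneq k i; first by lra.
    by have [_|_] := eqVneq k j; [exact: ltW | exact: q0].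
  - rewrite split2 q'i q'j (eq_bigr _ q'k) -q1 split2; ring.
  (* The decrease is strict, so the original sum is positive and no equality case arises here. *)
  suff lt : \sum_(k in U) gap K (q' k) < \sum_(k in U) gap K (q k).
    by split; [exact: ltW (le_lt_trans ge0 lt) | lra].
  rewrite !split2 q'i q'j (eq_bigr (fun k => gap K (q k))) => [|k /q'k -> //].
  by have := gap_spread K0 x00 _ xj ji le1; rewrite xK lexx => /(_ isT); lra.
rewrite negb_exists => /forallP noij.
have /card_gt0P[i1 i1U] : (0 < #|U|)%N by rewrite cU.
have [i0 i0U' q_max'] := @arg_maxP _ _ _ i1 (mem U) q i1U.
have i0U : i0 \in U := i0U'.
have q_max i : i \in U -> q i <= q i0 := @q_max' i.
have small i : i \in U :\ i0 -> q i <= x0.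
  rewrite in_setD1 => /andP[ii0 iU]; rewrite leNgt; apply/negP => xi.
  have := noij i0; rewrite negb_exists => /forallP/(_ i).
  by rewrite i0U iU eq_sym ii0 xi q_max.
have cU0 : #|U :\ i0| = m by apply/eqP; rewrite -eqSS -cU [in X in _ == X](cardsD1 i0) i0U.
set y := q i0 in q_max.
have rest (f : I -> R) : \sum_(i in U) f i = f i0 + \sum_(i in U :\ i0) f i.
  by rewrite (big_setD1 i0).
have restq : \sum_(i in U :\ i0) q i = 1 - y by rewrite -q1 rest -/y; ring.
have nneg i : i \in U :\ i0 -> 0 <= q i by rewrite in_setD1 => /andP[_]; exact: q0.
have y1 : 0 <= 1 - y by rewrite -restq sumr_ge0.
have ym : 1 <= y * m.+1%:R.
  have : \sum_(i in U) q i <= \sum_(i in U) y by apply: ler_sum => i; exact: q_max.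
  by rewrite q1 sumr_const cU mulr_natr.
have [z0|z0] := eqVneq (1 - y) 0.
  have qi0 : q i0 = 1 by rewrite -/y; lra.
  have q00 i : i \in U :\ i0 -> q i = 0.
    move=> iU; apply/eqP; move: restq; rewrite z0 => /eqP; rewrite psumr_eq0 //.
    by move=> /allP/(_ i (mem_index_enum _))/implyP; apply.
  split; last by left; exists i0.
  rewrite rest qi0 gap1 add0r big1 // => i iU; by rewrite q00 // gap0.
have {y1 z0} z0 : 0 < 1 - y by rewrite lt0r z0.
have m0 : 0 < m%:R :> R by lra.
pose t := (1 - y) / m%:R.
have tK : (1 + K) * t <= K.
  apply: below; rewrite ler_pdivrMr // -restq.
  have : \sum_(i in U :\ i0) q i <= \sum_(i in U :\ i0) x0 by apply: ler_sum.
  by rewrite sumr_const cU0 mulr_natr.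
have le_spike : spike K m%:R (1 - y) <= \sum_(i in U) gap K (q i).
  rewrite rest /spike subKr -/y lerD2l -/t.
  (* The linear terms of the tangent cancel because t is the mean of the remaining weights. *)
  have -> : m%:R * gap K t = \sum_(i in U :\ i0) (gap K t + dgap K t * (q i - t)).
    rewrite big_split /= sumr_const cU0 -mulr_sumr sumrB restq sumr_const cU0.
    have -> : t *+ m = 1 - y by rewrite -mulr_natr divfK ?gt_eqF.
    by rewrite subrr mulr0 addr0 mulr_natl.
  apply: ler_sum => i iU; apply: gap_tangent => //; last 2 first.
  - exact: nneg.
  - by apply/below/small.
  - by rewrite divr_gt0.
(* Either the largest weight equals the mean 1/(m + 1), and all weights agree, or [spike] is
   strictly positive. *)
move: ym; rewrite le_eqVlt => /predU1P[ym|ym].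
  have yE : y = m.+1%:R^-1.
    by rewrite -[y](mulfK (_ : m.+1%:R != 0)) ?pnatr_eq0 // -ym mul1r.
  have all_eq : {in U, forall i, q i = m.+1%:R^-1}.
    have : \sum_(i in U) (y - q i) == 0.
      by rewrite sumrB q1 sumr_const cU -mulr_natr -ym subrr.
    rewrite psumr_eq0 => [/allP h i iU|i iU]; last by rewrite subr_ge0 q_max.
    by have := implyP (h i (mem_index_enum _)) iU; rewrite subr_eq0 -yE => /eqP.
  split=> [|_]; last by right.
  by rewrite big1 // => i /all_eq ->.
suff : 0 < \sum_(i in U) gap K (q i) by split; [exact: ltW | lra].
apply: lt_le_trans le_spike; apply: spike_gt0 => //; rewrite natr1 //.
by rewrite mulrBl mul1r -natr1 in ym *; lra.
Qed.

(** * The constant K and the inequality for weights of arbitrary sum *)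

Definition merge_const (R : realType) (n : nat) : R :=
  n.-1%:R * (ln n%:R - ln n.-1%:R) / ln n%:R.

(** With x = n - 1 the claim is (x - 1) (ln (x + 1) - ln x) < ln x, and 1 - 1/x separates the two
    sides. *)
Lemma merge_const_lt1 (R : realType) (n : nat) : (2 < n)%N -> merge_const R n < 1.
Proof.
case: n => [|[|[|m]]] // _; rewrite /merge_const /= -[m.+3%:R]natr1.
have : 2 <= m.+2%:R :> R by rewrite ler_nat.
move: m.+2%:R => x x2.
have lx : 0 < ln (x + 1) by rewrite ln_gt0 //; lra.
rewrite ltr_pdivrMr // mul1r.
have x0 : 0 < x by lra.
have xx1 : x < x + 1 by lra.
have /andP[_] := ln_diff_bounds x0 xx1.
rewrite [x + 1 - x]addrC addKr div1r => h.
have lx1 : 1 - x^-1 <= ln x.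
  have := @ln_le_subr1 _ x^-1; rewrite invr_gt0 lnV ?posrE // => /(_ x0); lra.
have : (x - 1) * (ln (x + 1) - ln x) < (x - 1) * x^-1 by rewrite ltr_pM2l //; lra.
by rewrite [X in _ < X]mulrBl divff ?gt_eqF //; lra.
Qed.

Lemma bernoulli_strict (R : realType) (a : R) (k : nat) :
  0 < a -> 1 + k.+2%:R * a < (1 + a) ^+ k.+2.
Proof.
move=> a0; elim: k => [|k IHk]; first by rewrite expr2; nra.
rewrite exprS.
have : (1 + a) * (1 + k.+2%:R * a) < (1 + a) * (1 + a) ^+ k.+2 by rewrite ltr_pM2l //; lra.
apply: le_lt_trans; rewrite -[k.+3%:R]natr1.
have : 0 <= k.+2%:R :> R by [].
nra.
Qed.

(** The claim is m + 1 < (1 + 1/m)^(m^2), which is Bernoulli's inequality with exponent m^2. *)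
Lemma merge_const_gt (R : realType) (m : nat) : (1 < m)%N -> 1 < merge_const R m.+1 * m%:R.
Proof.
move=> m1; have m0 : 0 < m%:R :> R by rewrite ltr0n (ltn_trans _ m1).
have lm : 0 < ln m.+1%:R :> R by rewrite ln_gt0 // ltr1n ltnW.
rewrite /merge_const /= mulrAC ltr_pdivlMr // mul1r.
have : 1 + (m * m)%:R * m%:R^-1 < (1 + m%:R^-1) ^+ (m * m) :> R.
  case: m m1 m0 {lm} => [|[|m]] // _ m0.
  rewrite mulSn addSn addnC -[(_ * _ + _)%N]/((_ + m.+1)%N) addnS.
  by apply: bernoulli_strict; rewrite invr_gt0.
have -> : 1 + m%:R^-1 = m.+1%:R / m%:R :> R by rewrite -natr1; field; rewrite gt_eqF.
rewrite natrM mulfK ?gt_eqF // addrC natr1.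
rewrite -ltr_ln ?posrE ?exprn_gt0 ?divr_gt0 // lnXn ?divr_gt0 // ln_div ?posrE //.
move: (ln _) (ln _) => x y; rewrite -[_ *+ _]mulr_natr (natrM R m m); lra.
Qed.

Lemma gap_merge_const (R : realType) (m : nat) : (0 < m)%N ->
  gap (merge_const R m.+1) m.+1%:R^-1 = 0.
Proof.
move=> m_gt0; have m0 : 0 < m%:R :> R by rewrite ltr0n.
have lm : 0 < ln m.+1%:R :> R by rewrite ln_gt0 // ltr1n.
have e : 1 - m.+1%:R^-1 = m%:R / m.+1%:R :> R.
  by rewrite -natr1; field; rewrite gt_eqF //; lra.
rewrite /gap /merge_const /xlnx e ln_div ?posrE // lnV ?posrE //.
by field; rewrite gt_eqF //= gt_eqF.
Qed.

(* Homogeneous form of [sum_gap_ge0]: [merge_const] is the constant making a uniform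
   family an equality case. *)
Lemma sum_xlnx_compl_le (R : realType) (I : finType) (U : {set I}) (q : I -> R) (m : nat) (T : R) :
    #|U| = m.+1 -> (1 < m)%N -> {in U, forall i, 0 <= q i} -> \sum_(i in U) q i = T ->
  \sum_(i in U) xlnx (T - q i) - m%:R * xlnx T <=
    merge_const R m.+1 * (\sum_(i in U) xlnx (q i) - xlnx T).
Proof.
move=> cU m1 q0 qT; have [T0|T0] := eqVneq T 0.
  have z i : i \in U -> q i = 0.
    move=> iU; apply/eqP; move: T0 => /eqP; rewrite -qT psumr_eq0 //.
    by move=> /allP/(_ i (mem_index_enum _))/implyP; apply.
  rewrite T0 xlnx0 !big1 => [|i /z ->|i /z ->]; rewrite ?subr0 ?xlnx0 //.
  by rewrite !mulr0 subrr.
have {}T0 : 0 < T by rewrite lt0r T0 -qT sumr_ge0.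
have le i : i \in U -> q i <= T.
  move=> iU; rewrite -qT (big_setD1 i) //= lerDl sumr_ge0 // => j.
  by rewrite in_setD1 => /andP[_ /q0].
have m0 := ltnW m1.
have [| |ge _] := @sum_gap_ge0 R I U (fun i => q i / T) m _ cU m1
   (merge_const_lt1 R (m1 : (2 < m.+1)%N))
   (merge_const_gt R m1) (gap_merge_const R m0) => //.
- by move=> i /q0 qi; rewrite divr_ge0 // ltW.
- by rewrite -mulr_suml qT divff ?gt_eqF.
move: ge; rewrite -(pmulr_rge0 _ T0) mulr_sumr.
have eT i : i \in U -> T * gap (merge_const R m.+1) (q i / T) =
    merge_const R m.+1 * xlnx (q i) - xlnx (T - q i)
      + (T - q i - merge_const R m.+1 * q i) * ln T.
  move=> iU; rewrite /gap.
  have e1 : xlnx (q i) = T * xlnx (q i / T) + (q i / T) * xlnx T.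
    by rewrite -xlnxM ?divr_ge0 ?(ltW T0) ?q0 // mulrC divfK ?gt_eqF.
  have e2 : xlnx (T - q i) = T * xlnx (1 - q i / T) + (1 - q i / T) * xlnx T.
    rewrite -xlnxM // ?subr_ge0 ?ler_pdivrMr ?mul1r ?le //.
    by congr xlnx; field; rewrite gt_eqF.
  by rewrite e1 e2 /xlnx; field; rewrite gt_eqF.
rewrite (eq_bigr _ eT) big_split /= sumrB -mulr_sumr -mulr_suml !sumrB sumr_const cU.
rewrite -mulr_sumr qT -[T *+ _]mulr_natl -[m.+1%:R]natr1 [xlnx T]/xlnx.
move: (\sum_(i in U) xlnx (q i)) (\sum_(i in U) xlnx (T - q i)) (ln T) => x y z; lra.
Qed.

(** * Averages over random orders of the columns *)

(** Here [s] lists the columns by position. A uniform [s] makes the first t columns a uniform set S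
    of size t, and this is q(S). *)
Definition head_sum (R : realType) (n : nat) (q : 'I_n -> R) (s : 'S_n) (t : nat) : R :=
  \sum_(l < n | (l < t)%N) q (s l).

Lemma head_sumS (R : realType) (n : nat) (q : 'I_n -> R) (s : 'S_n) (l : 'I_n) :
  head_sum q s l.+1 = q (s l) + head_sum q s l.
Proof.
rewrite /head_sum (bigD1 l) //=; congr (_ + _); apply: eq_bigl => k.
by rewrite ltnS [(k < l)%N]ltn_neqAle andbC.
Qed.

Lemma head_sum_full (R : realType) (n : nat) (q : 'I_n -> R) (s : 'S_n) :
  head_sum q s n = \sum_j q j.
Proof.
rewrite [RHS](reindex_inj (@perm_inj _ s)) /=; apply: eq_bigl => l.
exact: ltn_ord.
Qed.

(** Exchangeability of the positions in the head: composing [s] with the transposition of k and l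
    keeps the set of the first t columns. *)
Lemma head_sum_exchange (R : realType) (n : nat) (q : 'I_n -> R) (F : R -> R -> R)
    (t : nat) (k l : 'I_n) : (k < t)%N -> (l < t)%N ->
  \sum_(s : 'S_n) F (q (s k)) (head_sum q s t) =
  \sum_(s : 'S_n) F (q (s l)) (head_sum q s t).
Proof.
move=> kt lt; rewrite (reindex_inj (mulgI (tperm k l))) /=.
apply: eq_bigr => s _; rewrite permM tpermL; congr F.
rewrite /head_sum (reindex_inj (@perm_inj _ (tperm k l))) /=; apply: eq_big => i.
  by case: tpermP => [->|->|//]; rewrite kt lt.
by rewrite permM tpermK.
Qed.

Lemma card_ord_lt (n t : nat) : (t <= n)%N -> #|[set l : 'I_n | (l < t)%N]| = t.
Proof.
move=> tn; rewrite -sum1_card.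
under eq_bigl do rewrite inE.
by rewrite (big_ord_narrow tn) /= sum1_card card_ord.
Qed.

Lemma sum_head_exchange (R : realType) (n : nat) (q : 'I_n -> R) (F : R -> R -> R)
    (t : nat) (k : 'I_n) : (k < t)%N -> (t <= n)%N ->
  \sum_(s : 'S_n) \sum_(l in [set l : 'I_n | (l < t)%N]) F (q (s l)) (head_sum q s t) =
  t%:R * \sum_(s : 'S_n) F (q (s k)) (head_sum q s t).
Proof.
move=> kt tn; rewrite exchange_big /= -[in X in X * _](card_ord_lt tn) mulr_natl -sumr_const.
by apply: eq_bigr => l; rewrite inE => lt; exact: head_sum_exchange.
Qed.

(** The V_t of the overview: a sum over the n! orders is n! times an average over sets of size t. *)
Definition mean_head (R : realType) (n : nat) (q : 'I_n -> R) (t : nat) : R :=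
  (\sum_(s : 'S_n) xlnx (head_sum q s t)) / t%:R.

(** Monotonicity of (V_t - V_1) / ln t with denominators cleared, so that t = 1 is allowed. The
    weight inequality is applied to the first m + 1 columns of each order; leaving one out gives, by
    exchangeability, a head of size m. *)
Lemma mean_head_step (R : realType) (n : nat) (q : 'I_n -> R) (m : nat) :
    (forall j, 0 <= q j) -> (0 < m)%N -> (m < n)%N ->
  (mean_head q m - mean_head q 1) * ln m.+1%:R <=
    (mean_head q m.+1 - mean_head q 1) * ln m%:R.
Proof.
move=> q0; rewrite leq_eqVlt => /predU1P[<-|m1] mn; first by rewrite ln1 subrr mul0r mulr0.
pose k := Ordinal mn.
have n0 : (0 < n)%N := leq_ltn_trans (leq0n m) mn.
pose k0 := Ordinal n0.
have lnm : 0 < ln m.+1%:R :> R by rewrite ln_gt0 // ltr1n ltnS ltnW.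
have m0 : 0 < m%:R :> R by rewrite ltr0n ltnW.
pose U := [set l : 'I_n | (l < m.+1)%N].
have e1 (s : 'S_n) : head_sum q s m.+1 - q (s k) = head_sum q s m.
  by rewrite (head_sumS q s k) addrC addKr.
have e2 (s : 'S_n) : q (s k0) = head_sum q s 1.
  by rewrite (head_sumS q s k0) {1}/head_sum big_pred0 // addr0.
have h1 : \sum_(s : 'S_n) \sum_(l in U) xlnx (head_sum q s m.+1 - q (s l)) =
    m.+1%:R * (m%:R * mean_head q m).
  rewrite (@sum_head_exchange _ _ q (fun a b => xlnx (b - a)) _ k) //.
  by under eq_bigr do rewrite e1; rewrite /mean_head [m%:R * _]mulrC divfK ?gt_eqF.
have h2 : \sum_(s : 'S_n) \sum_(l in U) xlnx (q (s l)) = m.+1%:R * mean_head q 1.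
  rewrite (@sum_head_exchange _ _ q (fun a b => xlnx a) _ k0) //.
  by under eq_bigr do rewrite e2; rewrite /mean_head divr1.
have h3 : \sum_(s : 'S_n) xlnx (head_sum q s m.+1) = m.+1%:R * mean_head q m.+1.
  by rewrite /mean_head mulrC divfK ?pnatr_eq0.
have : \sum_(s : 'S_n) (\sum_(l in U) xlnx (head_sum q s m.+1 - q (s l))
      - m%:R * xlnx (head_sum q s m.+1)) <=
    \sum_(s : 'S_n) merge_const R m.+1 *
      (\sum_(l in U) xlnx (q (s l)) - xlnx (head_sum q s m.+1)).
  apply: ler_sum => s _; apply: sum_xlnx_compl_le => //; first exact: card_ord_lt.
  by apply: eq_bigl => l; rewrite inE.
rewrite sumrB h1 -mulr_sumr h3 -mulr_sumr sumrB h2 h3 /merge_const /=.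
move: (mean_head q m) (mean_head q 1) (mean_head q m.+1) => a b c.
set u := ln m.+1%:R in lnm *; set v := ln m%:R => h.
have mm : 0 < m.+1%:R * m%:R :> R by rewrite mulr_gt0.
rewrite -(ler_pM2l mm) -subr_ge0.
have := h; rewrite -(ler_pM2r lnm) -subr_ge0.
by congr (0 <= _); field; rewrite gt_eqF.
Qed.

Lemma mean_head_interp (R : realType) (n : nat) (q : 'I_n -> R) (t : nat) :
    (forall j, 0 <= q j) -> (0 < t)%N -> (t <= n)%N ->
  (mean_head q t - mean_head q 1) * ln n%:R <= (mean_head q n - mean_head q 1) * ln t%:R.
Proof.
move=> q0 + tn; have [d] := ubnP (n - t); elim: d t tn => // d IHd t.
rewrite leq_eqVlt => /predU1P[-> //|tn] td t0.
have lt1 : 0 < ln t.+1%:R :> R by rewrite ln_gt0 // ltr1n.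
have lnt : 0 <= ln t%:R :> R by rewrite ln_ge0 // ler1n.
have lnn : 0 <= ln n%:R :> R by rewrite ln_ge0 // ler1n (leq_trans t0) // ltnW.
have h1 := mean_head_step q0 t0 tn.
have h2 : (mean_head q t.+1 - mean_head q 1) * ln n%:R <=
  (mean_head q n - mean_head q 1) * ln t.+1%:R.
  by apply: IHd => //; rewrite -ltnS; apply: leq_trans td; rewrite ltnS ltn_sub2l.
rewrite -(ler_pM2r lt1).
have := ler_wpM2r lnn h1; have := ler_wpM2r lnt h2; lra.
Qed.

(** * The revealed entropy of a row against its entropy *)

Definition entropy (R : realType) (n : nat) (q : 'I_n -> R) : R := - \sum_j xlnx (q j).

(* The mean over orders [s] of the columns of the cross entropy that is left for a row with
   marginal [q] when the columns revealed before it are excluded. *)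
Definition revealed_entropy (R : realType) (n : nat) (q : 'I_n -> R) : R :=
  \sum_j q j * ((\sum_(s : 'S_n) ln (\sum_(k | (s k <= s j)%N) q k)) / n`!%:R - ln (q j)).

(** The logarithmic terms are grouped by the position of the column. By exchangeability, the last
    column of a head of size t carries on average 1/t of the head's weight. *)
Lemma revealed_entropyE (R : realType) (n : nat) (q : 'I_n -> R) :
  revealed_entropy q = entropy q + (\sum_(t < n) mean_head q t.+1) / n`!%:R.
Proof.
rewrite /revealed_entropy.
under eq_bigr do rewrite mulrBr mulrA.
rewrite sumrB addrC; congr (_ + _); rewrite -mulr_suml; congr (_ / _).
under eq_bigr do rewrite mulr_sumr.
(* Inversion passes from [s] giving the position of a column to [s] listing columns by position. *)
rewrite exchange_big /= (reindex_inj invg_inj) /=.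
transitivity (\sum_(s : 'S_n) \sum_(l < n) q (s l) * ln (head_sum q s l.+1)).
  apply: eq_bigr => s _; rewrite (reindex_inj (@perm_inj _ s)) /=.
  apply: eq_bigr => l _; congr (_ * ln _).
  rewrite (reindex_inj (@perm_inj _ s)) /= permK; apply: eq_bigl => k.
  by rewrite permK.
rewrite exchange_big /=; apply: eq_bigr => l _.
apply: (mulfI (_ : l.+1%:R != 0)); first by rewrite pnatr_eq0.
rewrite -(@sum_head_exchange _ _ q (fun a b => a * ln b) _ l) // /mean_head.
rewrite [RHS]mulrC divfK ?pnatr_eq0 //; apply: eq_bigr => s _.
by rewrite -mulr_suml; congr (_ * _); apply: eq_bigl => k; rewrite inE.
Qed.

Lemma sum_perm_eval (R : realType) (n : nat) (f : 'I_n -> R) (k : 'I_n) :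
  n%:R * \sum_(s : 'S_n) f (s k) = n`!%:R * \sum_j f j.
Proof.
rewrite -(@sum_head_exchange _ _ f (fun a b => a) n) // -card_Sn mulr_natl -sumr_const.
apply: eq_bigr => s _; rewrite [RHS](reindex_inj (@perm_inj _ s)) /=.
by apply: eq_bigl => l; rewrite inE ltn_ord.
Qed.

Lemma mean_head1 (R : realType) (n : nat) (q : 'I_n -> R) :
  n%:R * mean_head q 1 = - n`!%:R * entropy q.
Proof.
case: n q => [|n] q; first by rewrite mul0r /entropy big_ord0 oppr0 mulr0.
rewrite /entropy mulrNN -(sum_perm_eval (fun j => xlnx (q j)) ord0) /mean_head divr1.
congr (_ * _); apply: eq_bigr => s _.
by rewrite (head_sumS q s ord0) {1}/head_sum big_pred0 // addr0.
Qed.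

Lemma sum_ln_fact (R : realType) (n : nat) : \sum_(t < n) ln t.+1%:R = ln n`!%:R :> R.
Proof.
elim: n => [|n IHn]; first by rewrite big_ord0 ln1.
by rewrite big_ord_recr /= IHn factS natrM addrC lnM ?posrE // ltr0n fact_gt0.
Qed.

Lemma mean_head_full (R : realType) (n : nat) (q : 'I_n -> R) :
  \sum_j q j = 1 -> mean_head q n = 0.
Proof.
move=> q1; rewrite /mean_head big1 ?mul0r // => s _.
by rewrite head_sum_full q1 xlnx1.
Qed.

Lemma mean_head_defect_ge0 (R : realType) (n : nat) (q : 'I_n -> R) (t : 'I_n) :
    (forall j, 0 <= q j) -> \sum_j q j = 1 ->
  0 <= mean_head q 1 * (ln n%:R - ln t.+1%:R) - mean_head q t.+1 * ln n%:R.
Proof.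
move=> q0 q1; have := @mean_head_interp R n q t.+1 q0 isT (ltn_ord t).
by rewrite mean_head_full //; lra.
Qed.

(** The slack of the entropy bound is, up to positive factors when 0 < n, a sum of the slacks of
    [mean_head_interp]. So it is nonnegative, and vanishes only if each of them does. *)
Lemma revealed_entropy_defect (R : realType) (n : nat) (q : 'I_n -> R) :
  n%:R * n`!%:R * (entropy q * ln n`!%:R - n%:R * ln n%:R * revealed_entropy q) =
  n%:R * n%:R * \sum_(t < n) (mean_head q 1 * (ln n%:R - ln t.+1%:R) - mean_head q t.+1 * ln n%:R).
Proof.
have F0 : n`!%:R != 0 :> R by rewrite pnatr_eq0 -lt0n fact_gt0.
rewrite revealed_entropyE sumrB -mulr_sumr -mulr_suml sumrB sum_ln_fact sumr_const card_ord.
have := mean_head1 q.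
rewrite -[_ *+ n]mulr_natl.
move: (mean_head q 1) (entropy q) (\sum_(t < n) _) (ln _) (ln _) => a H S x y e.
transitivity ((- n`!%:R * H) * (n%:R * n%:R * x - n%:R * y) - n%:R * n%:R * S * x).
  by field.
by rewrite -e; ring.
Qed.

Lemma revealed_entropy_le (R : realType) (n : nat) (q : 'I_n -> R) :
    (forall j, 0 <= q j) -> \sum_j q j = 1 ->
  n%:R * ln n%:R * revealed_entropy q <= entropy q * ln n`!%:R.
Proof.
move=> q0 q1.
have n0 : (0 < n)%N.
  by case: n q q1 {q0} => // q /eqP; rewrite big_ord0 eq_sym oner_eq0.
rewrite -subr_ge0 -(@pmulr_rge0 _ (n%:R * n`!%:R)) ?mulr_gt0 ?ltr0n ?fact_gt0 //.
by rewrite revealed_entropy_defect !mulr_ge0 // sumr_ge0 // => t _; exact: mean_head_defect_ge0.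
Qed.

Lemma revealed_entropy_eq (R : realType) (n : nat) (q : 'I_n -> R) :
    (forall j, 0 <= q j) -> \sum_j q j = 1 -> (2 < n)%N ->
    n%:R * ln n%:R * revealed_entropy q = entropy q * ln n`!%:R ->
  (exists j, q j = 1) \/ (forall j, q j = n%:R^-1).
Proof.
move=> q0 q1 n2 /eqP; rewrite eq_sym -subr_eq0 => /eqP e.
have n0 : 0 < n%:R :> R by rewrite ltr0n ltnW // ltnW.
have /eqP := revealed_entropy_defect q; rewrite e mulr0 eq_sym mulf_eq0 gt_eqF ?mulr_gt0 //=.
rewrite psumr_eq0 => [/allP z|t _]; last exact: mean_head_defect_ge0.
case: n q n2 n0 q0 q1 z {e} => // -[|m] // p m1 _ p0 p1 z.
have mm : (m < m.+2)%N by [].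
have m1' : (1 < m.+1)%N := m1.
(* The slack for sets of size n - 1 suffices: such a set omits one column, which turns the slack
   into the sum of [gap] over all weights. *)
have /= := z (Ordinal mm) (mem_index_enum _).
have mR : m.+1%:R != 0 :> R by rewrite pnatr_eq0.
have F0 : m.+2`!%:R != 0 :> R by rewrite pnatr_eq0 -lt0n fact_gt0.
have lnm : ln m.+2%:R != 0 :> R by rewrite gt_eqF // ln_gt0 // ltr1n.
have h : m.+2%:R * (m.+1%:R * mean_head p m.+1) = m.+2`!%:R * \sum_j xlnx (1 - p j).
  rewrite -(sum_perm_eval (fun j => xlnx (1 - p j)) ord_max) /mean_head.
  rewrite [m.+1%:R * _]mulrC divfK //; congr (_ * _); apply: eq_bigr => s _.
  by rewrite -p1 -(head_sum_full p s) (head_sumS p s ord_max) addrC addKr.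
have h1 := mean_head1 p.
rewrite subr_eq0 => /eqP eq.
have sum0 : \sum_(j in [set: 'I_m.+2]) gap (merge_const R m.+2) (p j) = 0.
  have -> : \sum_(j in [set: 'I_m.+2]) gap (merge_const R m.+2) (p j) =
      merge_const R m.+2 * \sum_j xlnx (p j) - \sum_j xlnx (1 - p j).
    by rewrite mulr_sumr -sumrB; apply: eq_bigl => j; rewrite inE.
  apply: (mulfI F0); rewrite mulr0 mulrBr -h mulrCA.
  have -> : m.+2`!%:R * \sum_j xlnx (p j) = m.+2%:R * mean_head p 1.
    by rewrite h1 /entropy mulrNN.
  rewrite /merge_const /=; move/eqP: eq; rewrite -subr_eq0 => /eqP eq.
  apply: (mulIf lnm); rewrite mul0r -[RHS](mulr0 (m.+2%:R * m.+1%:R)) -eq.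
  by field.
have cU : #|[set: 'I_m.+2]| = m.+2 by rewrite cardsT card_ord.
have [||_] := @sum_gap_ge0 R _ _ p _ _ cU m1' (merge_const_lt1 R m1)
    (merge_const_gt R m1') (gap_merge_const R (ltn0Sn m)).
- by move=> j _; exact: p0.
- by rewrite -[RHS]p1; apply: eq_bigl => j; rewrite inE.
move=> /(_ sum0) [[j _ pj]|all_eq]; first by left; exists j.
by right=> j; apply: all_eq; rewrite inE.
Qed.

(** * Gibbs' inequality *)

Lemma gibbs_term (R : realType) (a b : R) : 0 <= a -> 0 <= b -> (0 < a -> 0 < b) ->
  a * (ln b - ln a) <= b - a ?= iff (a == b).
Proof.
rewrite le_eqVlt => /predU1P[<-|a0] b0 ab; split.
- by rewrite mul0r subr0.
- by rewrite mul0r subr0.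
- have := ln_le_subr1 (divr_gt0 (ab a0) a0); rewrite ln_div ?posrE ?ab // -(ler_pM2l a0).
  by rewrite [X in _ <= X]mulrBr mulr1 mulrCA divff ?gt_eqF // mulr1.
have [->|neq] := eqVneq a b; first by rewrite !subrr mulr0 eqxx.
have ba : b / a != 1.
  by apply: contra neq => /eqP/divr1_eq ->.
have := ln_lt_subr1 (divr_gt0 (ab a0) a0) ba; rewrite ln_div ?posrE ?ab // -(ltr_pM2l a0).
by rewrite [X in _ < X]mulrBr mulr1 mulrCA divff ?(gt_eqF a0) // mulr1 => /lt_eqF.
Qed.

(** The total of [b] may be smaller than that of [a], since the sequential law to be compared with
    can lose mass. *)
Lemma gibbs (R : realType) (I : finType) (a b : I -> R) :
    (forall i, 0 <= a i) -> (forall i, 0 <= b i) -> (forall i, 0 < a i -> 0 < b i) ->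
    \sum_i b i <= \sum_i a i ->
  \sum_i a i * (ln (b i) - ln (a i)) <= 0 /\
  (\sum_i a i * (ln (b i) - ln (a i)) = 0 -> forall i, a i = b i).
Proof.
move=> a0 b0 ab ba; have term i := gibbs_term (a0 i) (b0 i) (ab i).
have le : \sum_i a i * (ln (b i) - ln (a i)) <= \sum_i (b i - a i).
  by apply: ler_sum => i _; rewrite term.
have le0 : \sum_i (b i - a i) <= 0 by rewrite sumrB subr_le0.
split=> [|e i]; first exact: le_trans le le0.
have /eqP : \sum_i (b i - a i - a i * (ln (b i) - ln (a i))) = 0.
  by rewrite e in le; apply/eqP; rewrite sumrB e subr0 eq_le le0 le.
rewrite psumr_eq0 => [/allP/(_ i (mem_index_enum _))/=|j _]; last by rewrite subr_ge0 term.
by rewrite subr_eq0 eq_sym term => /eqP.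
Qed.

(** * The entropy of a law on permutations *)

Lemma big_lift_perm_max (R : realType) (n : nat) (F : 'S_n.+1 -> R) :
  \sum_s F s = \sum_j \sum_(s : 'S_n) F (lift_perm ord_max j s).
Proof.
rewrite pair_big /=; pose f (x : 'I_n.+1 * 'S_n) := lift_perm ord_max x.1 x.2.
have inj_f : injective f.
  move=> [j s] [j' s'] /permP e; rewrite /f /= in e.
  have ej : j = j' by have := e ord_max; rewrite !lift_perm_id.
  congr pair => //; apply/permP => k.
  by have := e (lift ord_max k); rewrite !lift_perm_lift ej => /lift_inj.
have bij_f : bijective f.
  by apply: inj_card_bij => //; rewrite card_prod card_ord !card_Sn factS.
by rewrite (reindex f) //; apply: onW_bij.
Qed.

(* The summand is the probability of [s] when rows n-1, ..., 0 draw in turn a column that is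
   still free, with probability proportional to the weights of that row. *)
Lemma sum_sequential_le1 (R : realType) (n : nat) (w : 'I_n -> 'I_n -> R) :
    (forall i j, 0 <= w i j) ->
  \sum_(s : 'S_n) \prod_i (w i (s i) / \sum_(k < n | (k <= i)%N) w i (s k)) <= 1.
Proof.
elim: n w => [|n IHn] w w0.
  under eq_bigr do rewrite big_ord0.
  by rewrite sumr_const card_Sn.
have widenE (i : 'I_n) : widen_ord (leqnSn n) i = lift ord_max i.
  by apply: val_inj; rewrite /= /bump leqNgt ltn_ord.
pose W := \sum_j w ord_max j.
rewrite big_lift_perm_max.
(* The last row draws column j; the remaining rows then draw from the other columns, to which the
   induction hypothesis applies. *)
have step j : \sum_(s : 'S_n) \prod_i (w i (lift_perm ord_max j s i) /
      \sum_(k < n.+1 | (k <= i)%N) w i (lift_perm ord_max j s k)) <= w ord_max j / W.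
  have Wj : 0 <= w ord_max j / W by rewrite divr_ge0 // sumr_ge0.
  apply: (le_trans _ (ler_piMl Wj (IHn (fun i k => w (lift ord_max i) (lift j k)) _))) => //.
  rewrite mulr_suml; apply: ler_sum => s _; rewrite big_ord_recr /= lift_perm_id.
  have -> : \sum_(k < n.+1 | (k <= n)%N) w ord_max (lift_perm ord_max j s k) = W.
    rewrite /W [RHS](reindex_inj (@perm_inj _ (lift_perm ord_max j s))).
    by apply: eq_bigl => k; rewrite -ltnS ltn_ord.
  rewrite le_eqVlt; apply/orP; left; apply/eqP; congr (_ * _); apply: eq_bigr => i _.
  rewrite [X in _ / X = _]big_mkcond big_ord_recr /= [(n <= i)%N]leqNgt ltn_ord addr0.
  rewrite widenE lift_perm_lift; congr (_ / _); rewrite [RHS]big_mkcond.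
  by apply: eq_bigr => k _; rewrite widenE lift_perm_lift.
apply: (le_trans (ler_sum _ (fun j _ => step j))); rewrite -mulr_suml -/W.
(* A row of total weight 0 contributes 0 by the convention for division, whence only an
   inequality. *)
by have [->|W0] := eqVneq W 0; rewrite ?mul0r ?divff.
Qed.

Lemma ln_prod (R : realType) (I : finType) (f : I -> R) :
  (forall i, 0 < f i) -> ln (\prod_i f i) = \sum_i ln (f i).
Proof.
move=> f0; suff : 0 < \prod_i f i /\ ln (\prod_i f i) = \sum_i ln (f i) by case.
elim/big_ind2: _ => [|x1 x2 y1 y2 [p1 <-] [p2 <-]|i _]; first by rewrite ln1.
  by rewrite mulr_gt0 // lnM.
by rewrite f0.
Qed.

Definition marginal (R : realType) (n : nat) (mu : 'S_n -> R) (i j : 'I_n) : R :=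
  \sum_(s : 'S_n | s i == j) mu s.

Lemma marginal_ge0 (R : realType) (n : nat) (mu : 'S_n -> R) (i j : 'I_n) :
  (forall s, 0 <= mu s) -> 0 <= marginal mu i j.
Proof. by move=> mu0; apply: sumr_ge0. Qed.

Lemma le_marginal (R : realType) (n : nat) (mu : 'S_n -> R) (i : 'I_n) (s : 'S_n) :
  (forall s, 0 <= mu s) -> mu s <= marginal mu i (s i).
Proof. by move=> mu0; rewrite /marginal (bigD1 s) //= lerDl sumr_ge0. Qed.

Lemma sum_marginal (R : realType) (n : nat) (mu : 'S_n -> R) (i : 'I_n) (f : 'I_n -> R) :
  \sum_j marginal mu i j * f j = \sum_s mu s * f (s i).
Proof.
rewrite [RHS](partition_big (fun s : 'S_n => s i) xpredT) //=; apply: eq_bigr => j _.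
by rewrite mulr_suml; apply: eq_bigr => s /eqP ->.
Qed.

Lemma sum_marginal_row (R : realType) (n : nat) (mu : 'S_n -> R) (i : 'I_n) :
  \sum_j marginal mu i j = \sum_s mu s.
Proof.
have := sum_marginal mu i (fun=> 1).
by under eq_bigr do rewrite mulr1; under [in RHS]eq_bigr do rewrite mulr1.
Qed.

Lemma sum_marginal_col (R : realType) (n : nat) (mu : 'S_n -> R) (j : 'I_n) :
  \sum_i marginal mu i j = \sum_s mu s.
Proof.
rewrite [RHS](partition_big (fun s : 'S_n => (s^-1)%g j) xpredT) //=.
apply: eq_bigr => i _; apply: eq_bigl => s.
by rewrite -[RHS](inj_eq (@perm_inj _ s)) permKV eq_sym.
Qed.

(** Gibbs' inequality for [mu] against the law [nu] in which the rows, by decreasing [p], draw free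
    columns with their marginals as weights. *)
Lemma cross_entropy_order (R : realType) (n : nat) (mu : 'S_n -> R) (p : 'S_n) :
    (forall s, 0 <= mu s) -> \sum_s mu s = 1 ->
  - \sum_s xlnx (mu s) <= \sum_s mu s * \sum_i
    (ln (\sum_(k | (p k <= p i)%N) marginal mu i (s k)) - ln (marginal mu i (s i))).
Proof.
move=> mu0 mu1; pose q := marginal mu.
have q0 i j : 0 <= q i j by exact: marginal_ge0.
pose nu (s : 'S_n) := \prod_i (q i (s i) / \sum_(k | (p k <= p i)%N) q i (s k)).
have nu0 s : 0 <= nu s.
  by apply: prodr_ge0 => i _; rewrite divr_ge0 // sumr_ge0.
have nu1 : \sum_s nu s <= 1.
  apply: le_trans (sum_sequential_le1 (fun i j => q0 ((p^-1)%g i) j)).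
  rewrite (reindex_inj (mulgI p)) le_eqVlt; apply/orP; left; apply/eqP.
  apply: eq_bigr => s _; rewrite /nu (reindex_inj (@perm_inj _ (p^-1)%g)).
  apply: eq_bigr => i _; rewrite permM permKV; congr (_ / _).
  rewrite (reindex_inj (@perm_inj _ (p^-1)%g)); apply: eq_big => k; rewrite permKV //.
  by rewrite permM permKV.
have qs (s : 'S_n) i : 0 < mu s -> 0 < q i (s i).
  by move/lt_le_trans; apply; apply: le_marginal.
have ds (s : 'S_n) i : 0 < mu s -> 0 < \sum_(k | (p k <= p i)%N) q i (s k).
  by move=> /(qs s i)/lt_le_trans; apply; rewrite (bigD1 i) //= lerDl sumr_ge0.
have pos s : 0 < mu s -> 0 < nu s.
  by move=> ms; apply: prodr_gt0 => i _; rewrite divr_gt0 ?qs ?ds.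
rewrite -mu1 in nu1; have [le _] := gibbs mu0 nu0 pos nu1.
rewrite lerNl -subr_le0 -!sumrN -big_split /=.
apply: le_trans le; rewrite le_eqVlt; apply/orP; left; apply/eqP.
apply: eq_bigr => s _; have := mu0 s; rewrite le_eqVlt => /predU1P[<-|ms].
  by rewrite xlnx0 !mul0r subr0 oppr0.
rewrite /nu ln_prod => [|i]; last by rewrite divr_gt0 ?qs ?ds.
rewrite /xlnx mulrBr; congr (_ - _); rewrite -mulrN -sumrN; congr (_ * _).
by apply: eq_bigr => i _; rewrite ln_div ?posrE ?qs ?ds // opprB.
Qed.

(* The average of [cross_entropy_order] over all orders of the rows. *)
Lemma entropy_perm_le (R : realType) (n : nat) (mu : 'S_n -> R) :
    (forall s, 0 <= mu s) -> \sum_s mu s = 1 ->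
  - \sum_s xlnx (mu s) <= \sum_i revealed_entropy (marginal mu i).
Proof.
move=> mu0 mu1; have F0 : 0 < n`!%:R :> R by rewrite ltr0n fact_gt0.
rewrite -(ler_pM2l F0) mulr_natl -[X in _ *+ X]card_Sn -sumr_const.
apply: (le_trans (ler_sum _ (fun p _ => cross_entropy_order p mu0 mu1))).
rewrite le_eqVlt; apply/orP; left; apply/eqP.
rewrite exchange_big /= mulr_sumr.
under eq_bigr do rewrite -mulr_sumr exchange_big /= mulr_sumr.
rewrite exchange_big /=; apply: eq_bigr => i _.
rewrite /revealed_entropy sum_marginal mulr_sumr; apply: eq_bigr => s _.
rewrite mulrCA; congr (_ * _).
rewrite sumrB sumr_const card_Sn -[ln _ *+ _]mulr_natl mulrBr; congr (_ - _).
(* For fixed [s], a uniform order of the rows is carried by [s] to a uniform order of the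
   columns. *)
rewrite [RHS]mulrC divfK ?gt_eqF // (reindex_inj (mulgI s)) /=; apply: eq_bigr => p _.
congr ln; rewrite [RHS](reindex_inj (@perm_inj _ s)) /=.
by apply: eq_bigl => k; rewrite !permM.
Qed.

(** * Estimates for a single row *)

Lemma entropy_ge0 (R : realType) (n : nat) (q : 'I_n -> R) :
    (forall j, 0 <= q j) -> \sum_j q j = 1 ->
  0 <= entropy q /\ (entropy q = 0 -> exists j, q j = 1).
Proof.
move=> q0 q1; have le1 j : q j <= 1 by rewrite -q1 (bigD1 j) //= lerDl sumr_ge0.
have t j : 0 <= - xlnx (q j) by rewrite -mulrN mulr_ge0 // oppr_ge0 ln_le0.
rewrite /entropy -sumrN; split; first exact: sumr_ge0.
move=> /eqP; rewrite psumr_eq0 // => /allP z.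
have [/existsP[j /eqP qj]|] := boolP [exists j, q j == 1]; first by exists j.
rewrite negb_exists => /forallP none; move/eqP: q1.
rewrite big1 => [|j _]; first by rewrite eq_sym oner_eq0.
have := z j (mem_index_enum _); rewrite /= oppr_eq0 mulf_eq0 => /orP[/eqP //|].
have := q0 j; rewrite le_eqVlt => /predU1P[<- //|qj].
by rewrite ln_eq0 // (negPf (none j)).
Qed.

Lemma entropy_le_ln (R : realType) (n : nat) (q : 'I_n -> R) :
    (forall j, 0 <= q j) -> \sum_j q j = 1 ->
  entropy q <= ln n%:R /\ (entropy q = ln n%:R -> forall j, q j = n%:R^-1).
Proof.
move=> q0 q1; have n0 : (0 < n)%N.
  by case: n q q1 {q0} => // q /eqP; rewrite big_ord0 eq_sym oner_eq0.
have nR : 0 < n%:R :> R by rewrite ltr0n.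
have u0 : 0 < n%:R^-1 :> R by rewrite invr_gt0.
have u1 : \sum_(j < n) n%:R^-1 <= \sum_j q j.
  by rewrite q1 sumr_const card_ord -[_^-1 *+ _]mulr_natr mulVf // gt_eqF.
have [le eq] := gibbs q0 (fun=> ltW u0) (fun _ _ => u0) u1.
have e : \sum_j q j * (ln n%:R^-1 - ln (q j)) = entropy q - ln n%:R.
  under eq_bigr do rewrite mulrBr.
  by rewrite sumrB -mulr_suml q1 lnV ?posrE // /entropy; ring.
by rewrite e in le eq; split=> [|h]; [lra | apply: eq; lra].
Qed.

Lemma ln_extremal_ratio (R : realType) (n : nat) (p : R) : (0 < n)%N ->
  ln (n`!%:R / n%:R `^ (n%:R / p)) = ln n`!%:R - n%:R / p * ln n%:R.
Proof.
move=> n0; rewrite ln_div ?posrE ?powR_gt0 ?ltr0n ?fact_gt0 //.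
by rewrite ln_powR.
Qed.

Lemma extremal_ratio_gt0 (R : realType) (n : nat) (p : R) :
  0 < n`!%:R / n%:R `^ (n%:R / p) :> R.
Proof.
rewrite divr_gt0 ?ltr0n ?fact_gt0 //.
by case: n => [|n]; rewrite ?mul0r ?powRr0 // powR_gt0.
Qed.

(** For n > 1 put c = ln n! / (n ln n), so ln ratio = n ln n (c - 1/p). From c H the bound follows
    by H >= 0 if ratio < 1 and by H <= ln n if ratio > 1, with Dirac and uniform equality cases. If
    ratio = 1, both can occur. *)
Lemma revealed_entropy_bound (R : realType) (n : nat) (q : 'I_n -> R) (p : R) :
    (forall j, 0 <= q j) -> \sum_j q j = 1 -> 0 < p ->
  let ratio := n`!%:R / n%:R `^ (n%:R / p) in
  revealed_entropy q <= entropy q / p + ln (Num.max 1 ratio) / n%:R /\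
  (~ (n = 2%N /\ p = 2) ->
    revealed_entropy q = entropy q / p + ln (Num.max 1 ratio) / n%:R ->
    (ratio <= 1 /\ exists j, q j = 1) \/ (1 <= ratio /\ forall j, q j = n%:R^-1)).
Proof.
move=> q0 q1 p0 ratio; have n0 : (0 < n)%N.
  by case: n q q1 {q0 ratio} => // q /eqP; rewrite big_ord0 eq_sym oner_eq0.
have nR : 0 < n%:R :> R by rewrite ltr0n.
have [H0 Heq0] := entropy_ge0 q0 q1; have [Hn Heqn] := entropy_le_ln q0 q1.
have [n1|n2] := leqP n 1.
  have nE : n = 1%N by apply/eqP; rewrite eqn_leq n1.
  have H_0 : entropy q = 0.
    by apply/eqP; rewrite eq_le H0 andbT (le_trans Hn) // nE ln1.
  have r1 : ratio = 1 by rewrite /ratio nE powR1 divr1.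
  have re0 : revealed_entropy q = 0.
    rewrite revealed_entropyE H_0 big1 ?mul0r ?addr0 // => t _.
    rewrite -(mean_head_full q1).
    by congr mean_head; apply/eqP; rewrite eqn_leq ltn_ord (leq_trans n1).
  rewrite r1 maxxx ln1 re0 H_0 !mul0r addr0; split=> // _ _.
  by left; split=> //; exact: Heq0.
have lnn : 0 < ln n%:R :> R by rewrite ln_gt0 // ltr1n.
have le := revealed_entropy_le q0 q1.
have lr : ln ratio = ln n`!%:R - n%:R / p * ln n%:R by exact: ln_extremal_ratio.
have r0 : 0 < ratio by exact: extremal_ratio_gt0.
have eq := revealed_entropy_eq q0 q1.
have np0 : 0 < n%:R * ln n%:R :> R by rewrite mulr_gt0.
set H := entropy q in H0 Heq0 Hn Heqn le eq *; set re := revealed_entropy q in le eq *.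
have scale x y : (x <= H / p + y / n%:R) =
    (n%:R * ln n%:R * x <= n%:R / p * ln n%:R * H + ln n%:R * y).
  rewrite -(ler_pM2l np0); congr (_ <= _); field.
  by rewrite !gt_eqF.
have scale_eq x y : x = H / p + y / n%:R ->
    n%:R * ln n%:R * x = n%:R / p * ln n%:R * H + ln n%:R * y.
  by move=> ->; field; rewrite !gt_eqF.
have [r1|r1|r1] := ltgtP ratio 1.
- rewrite ln1; have lr0 : ln ratio < 0 by apply: ln_lt0; rewrite r0.
  split; first by rewrite scale; nra.
  move=> _ /scale_eq e; left; split=> //.
  by apply: Heq0; nra.
- have lr0 : 0 < ln ratio by exact: ln_gt0.
  split; first by rewrite scale; nra.
  move=> _ /scale_eq e; right; split=> //.
  by apply: Heqn; nra.
rewrite ?r1 ln1; rewrite r1 ln1 in lr.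
have lrE : n%:R / p * ln n%:R = ln n`!%:R by lra.
split; first by rewrite scale lrE; lra.
move=> n2p /scale_eq; rewrite lrE => e.
have [n3|n3] := ltnP 2 n.
  by case: eq => // [|u|u]; [rewrite e; ring | left | right].
(* For n = 2, ratio = 1 reads (2/p) ln 2 = ln 2, which is the excluded p = 2. *)
case: n2p; have nE : n = 2%N by apply/eqP; rewrite eqn_leq n3.
split=> //; move: lrE lnn; rewrite nE /= => lrE lnn.
have : 2 / p = 1 by apply: (mulIf (lt0r_neq0 lnn)); rewrite lrE mul1r.
by move/divr1_eq.
Qed.

Lemma gibbs_lpnorm (R : realType) (n : nat) (p : R) (A : 'M[R]_n) (i : 'I_n)
    (q : 'I_n -> R) :
    0 < p -> (forall j, 0 <= A i j) ->
    (forall j, 0 <= q j) -> \sum_j q j = 1 -> (forall j, 0 < q j -> 0 < A i j) ->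
  [/\ 0 < lpnorm p (row i A),
      entropy q / p + \sum_j q j * ln (A i j) <= ln (lpnorm p (row i A))
    & entropy q / p + \sum_j q j * ln (A i j) = ln (lpnorm p (row i A)) ->
      forall j, q j = A i j `^ p / \sum_k A i k `^ p].
Proof.
move=> p0 A0 q0 q1 qA; set N := \sum_k A i k `^ p.
have lpE : lpnorm p (row i A) = N `^ p^-1.
  by congr (_ `^ _); apply: eq_bigr => j _; rewrite mxE ger0_norm.
have N0 : 0 < N.
  rewrite lt0r sumr_ge0 ?andbT => [|k _]; last exact: powR_ge0.
  apply/eqP => /eqP; rewrite psumr_eq0 => [/allP z|k _]; last exact: powR_ge0.
  move/eqP: q1; rewrite big1 => [|j _]; first by rewrite eq_sym oner_eq0.
  apply/eqP; rewrite eq_le q0 andbT leNgt; apply/negP => /qA Aj.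
  have := z j (mem_index_enum _).
  by rewrite /= gt_eqF // powR_gt0.
have b0 j : 0 <= A i j `^ p / N by rewrite divr_ge0 ?powR_ge0 // ltW.
have b1 j : 0 < q j -> 0 < A i j `^ p / N by move=> /qA Aj; rewrite divr_gt0 ?powR_gt0.
have b2 : \sum_j A i j `^ p / N <= \sum_j q j by rewrite -mulr_suml divff ?gt_eqF ?q1.
have [le eq] := gibbs q0 b0 b1 b2.
have e : \sum_j q j * (ln (A i j `^ p / N) - ln (q j)) =
    p * (entropy q / p + \sum_j q j * ln (A i j) - ln (lpnorm p (row i A))).
  rewrite lpE ln_powR; transitivity (entropy q + p * (\sum_j q j * ln (A i j)) - ln N).
    2: by field; rewrite gt_eqF.
  rewrite /entropy mulr_sumr -[ln N]mul1r -q1 mulr_suml -sumrN -big_split -sumrB /=.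
  apply: eq_bigr => j _; have := q0 j; rewrite le_eqVlt => /predU1P[<-|qj].
    by rewrite xlnx0; ring.
  by rewrite ln_div ?posrE ?powR_gt0 ?qA // ln_powR /xlnx; ring.
rewrite e in le eq; split.
- by rewrite lpE powR_gt0.
- by rewrite -subr_le0 -(pmulr_rle0 _ p0).
by move=> h j; apply: eq; rewrite h subrr mulr0.
Qed.

(** For this [mu], ln perm A is exactly the entropy of [mu] plus the mean of the logarithm of the
    product; only the entropy is estimated. *)
Lemma ln_permanent_le (R : realType) (n : nat) (A : 'M[R]_n) :
    (forall i j, 0 <= A i j) -> 0 < permanent A ->
  let mu := fun s : 'S_n => (\prod_i A i (s i)) / permanent A in
  [/\ forall s, 0 <= mu s, \sum_s mu s = 1,
      forall i j, 0 < marginal mu i j -> 0 < A i j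
    & ln (permanent A) <=
      \sum_i (revealed_entropy (marginal mu i) + \sum_j marginal mu i j * ln (A i j))].
Proof.
move=> A0 P0 mu; have mu0 s : 0 <= mu s.
  by rewrite divr_ge0 ?(ltW P0) // prodr_ge0.
have mu1 : \sum_s mu s = 1 by rewrite -mulr_suml divff // gt_eqF.
have muA s : 0 < mu s -> forall i, 0 < A i (s i).
  move=> ms i; rewrite lt0r A0 andbT; apply: contraTN ms => /eqP Ai.
  by rewrite /mu (bigD1 i) //= Ai !mul0r ltxx.
split=> // [i j|].
  move=> m0; rewrite lt0r A0 andbT; apply: contraTN m0 => /eqP Aij.
  rewrite /marginal big1 ?ltxx // => s /eqP sij.
  by rewrite /mu (bigD1 i) //= sij Aij !mul0r.
have := entropy_perm_le mu0 mu1; rewrite big_split /=.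
have -> : \sum_i \sum_j marginal mu i j * ln (A i j) = \sum_s xlnx (mu s) + ln (permanent A).
  under eq_bigr do rewrite sum_marginal.
  rewrite exchange_big /= -[ln (permanent A)]mul1r -mu1 mulr_suml -big_split /=.
  apply: eq_bigr => s _; have := mu0 s; rewrite le_eqVlt => /predU1P[<-|ms].
    by rewrite xlnx0 mul0r addr0 big1 // => i _; rewrite mul0r.
  have pi0 : 0 < \prod_i A i (s i) by apply: prodr_gt0 => i _; exact: muA.
  rewrite -mulr_sumr -ln_prod; last exact: muA.
  rewrite /xlnx [in ln (mu s)]/mu ln_div ?posrE //; ring.
lra.
Qed.

(** * Permanents and norms of the extremal matrices *)

Lemma row_scaleE (R : realType) (n : nat) (A B : 'M[R]_n) (s : 'S_n) (c : 'I_n -> R)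
    (i j : 'I_n) :
  row i A = c i *: row (s i) B -> A i j = c i * B (s i) j.
Proof. by move=> /rowP/(_ j); rewrite !mxE. Qed.

Lemma permanent_row_perm_scale (R : realType) (n : nat) (A B : 'M[R]_n) (s : 'S_n)
    (c : 'I_n -> R) : (forall i, row i A = c i *: row (s i) B) ->
  permanent A = \prod_i c i * permanent B.
Proof.
move=> AB; rewrite /permanent (reindex_inj (mulgI s)) mulr_sumr /=.
apply: eq_bigr => t _; rewrite [X in _ = _ * X](reindex_inj (@perm_inj _ s)) -big_split /=.
by apply: eq_bigr => i _; rewrite permM (row_scaleE _ (AB i)).
Qed.

Lemma permanent1 (R : realType) (n : nat) : permanent (1%:M : 'M[R]_n) = 1.
Proof.
rewrite /permanent (bigD1 1%g) //= [X in X + _]big1 => [|i _]; last first.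
  by rewrite mxE perm1 eqxx.
rewrite big1 ?addr0 // => s s1; have [/forallP sE|] := boolP [forall i, s i == i].
  by case/eqP: s1; apply/permP => i; rewrite perm1; apply/eqP.
rewrite negb_forall => /existsP[i si]; rewrite (bigD1 i) //= mxE eq_sym.
by rewrite (negPf si) mul0r.
Qed.

Lemma permanent_const1 (R : realType) (n : nat) :
  permanent (const_mx 1 : 'M[R]_n) = n`!%:R.
Proof.
rewrite /permanent -card_Sn -sumr_const; apply: eq_bigr => s _.
by rewrite big1 // => i _; rewrite mxE.
Qed.

Lemma lpnormZ (R : realType) (n : nat) (p c : R) (x : 'rV[R]_n) :
  0 < p -> 0 <= c -> lpnorm p (c *: x) = c * lpnorm p x.
Proof.
move=> p0 c0; rewrite /lpnorm.
under eq_bigr do rewrite mxE normrM powRM // (ger0_norm c0).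
rewrite -mulr_sumr powRM ?powR_ge0 //; last by apply: sumr_ge0 => j _; exact: powR_ge0.
by rewrite -powRrM divff ?gt_eqF // powRr1.
Qed.

Lemma lpnorm_row1 (R : realType) (n : nat) (p : R) (i : 'I_n) :
  0 < p -> lpnorm p (row i (1%:M : 'M[R]_n)) = 1.
Proof.
move=> p0; rewrite /lpnorm (bigD1 i) //= !mxE eqxx normr1 powR1 big1 ?addr0 ?powR1 //.
by move=> j ji; rewrite !mxE eq_sym (negPf ji) normr0 powR0 // gt_eqF.
Qed.

Lemma lpnorm_row_const1 (R : realType) (n : nat) (p : R) (i : 'I_n) :
  lpnorm p (row i (const_mx 1 : 'M[R]_n)) = n%:R `^ p^-1.
Proof.
rewrite /lpnorm (eq_bigr (fun=> 1)) ?sumr_const ?card_ord // => j _.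
by rewrite !mxE normr1 powR1.
Qed.

(** * Combination of the row estimates and analysis of equality *)

(** The last clause excludes zero rows, which make both sides 0, and n = p = 2, where the bound is
    Cauchy-Schwarz, a d + b c <= |(a, b)| |(d, c)|, with further equality cases. *)
Theorem corollary1p14 (R : realType) (n : nat) (p : R) (A : 'M[R]_n)
    (p_ge1 : 1 <= p) (A_ge0 : forall i j, 0 <= A i j) :
  let ratio := n`!%:R / (n%:R `^ (n%:R / p)) in
  let bound := Num.max 1 ratio * \prod_(i < n) lpnorm p (row i A) in
  let extremal :=
    (ratio <= 1 /\ row_perm_scale_equiv A 1%:M) \/
    (1 <= ratio /\ row_perm_scale_equiv A (const_mx 1)) in
  [/\ permanent A <= bound,
      extremal -> permanent A = bound
    & (forall i, row i A != 0) -> ~ (n = 2%N /\ p = 2) ->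
      permanent A = bound -> extremal].
Proof.
move=> ratio bound extremal.
have p0 : 0 < p by apply: lt_le_trans p_ge1.
have M1 : 1 <= Num.max 1 ratio by rewrite le_max lexx.
have M0 : 0 < Num.max 1 ratio by apply: lt_le_trans M1.
have lp0 i : 0 <= lpnorm p (row i A) by exact: powR_ge0.
have sufficient : extremal -> permanent A = bound.
  have normE (s : 'S_n) (c : 'I_n -> R) (B : 'M[R]_n) :
      (forall i, 0 < c i) -> (forall i, row i A = c i *: row (s i) B) ->
    \prod_i lpnorm p (row i A) = \prod_i c i * \prod_i lpnorm p (row (s i) B).
    move=> c0 AB; rewrite -big_split; apply: eq_bigr => i _.
    by rewrite AB lpnormZ // ltW.
  case=> -[r1 [s [c [c0 AB]]]]; rewrite /bound (permanent_row_perm_scale AB) (normE s c _ c0 AB).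
    rewrite (max_l r1) mul1r permanent1; congr (_ * _).
    by rewrite big1 // => i _; rewrite lpnorm_row1.
  rewrite (max_r r1) permanent_const1 mulrCA; congr (_ * _).
  under eq_bigr do rewrite lpnorm_row_const1.
  rewrite prodr_const card_ord -powR_mulrn ?powR_ge0 // -powRrM mulrC [p^-1 * _]mulrC.
  rewrite /ratio [RHS]mulrC divfK //; case: (n) => [|k]; first by rewrite mul0r powRr0 oner_neq0.
  by rewrite gt_eqF // powR_gt0.
have P_ge0 : 0 <= permanent A by apply: sumr_ge0 => s _; exact: prodr_ge0.
have bound_ge0 : 0 <= bound by rewrite mulr_ge0 ?(ltW M0) // prodr_ge0.
have [P0|P0] := eqVneq (permanent A) 0.
  rewrite P0; split=> // [/sufficient|A0 _ e]; first by rewrite P0.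
  have : 0 < bound.
    rewrite mulr_gt0 // prodr_gt0 // => i _; rewrite powR_gt0 // lt0r.
    rewrite sumr_ge0 ?andbT => [|j _]; last exact: powR_ge0.
    apply: contra (A0 i) => z; apply/eqP/rowP => j; rewrite [in RHS]mxE; apply/eqP.
    move: z; rewrite psumr_eq0 => [|k _]; last exact: powR_ge0.
    by move=> /allP/(_ j (mem_index_enum _))/=; rewrite powR_eq0 normr_eq0 => /andP[].
  by rewrite -e ltxx.
have {P0 P_ge0} P0 : 0 < permanent A by rewrite lt0r P0.
have := ln_permanent_le A_ge0 P0; cbv zeta; set mu := fun s => _.
move=> [mu0 mu1 muA lnP].
have q0 i j := marginal_ge0 i j mu0.
have q1 i : \sum_j marginal mu i j = 1 by rewrite sum_marginal_row.
have lp i := gibbs_lpnorm p0 (A_ge0 i) (q0 i) (q1 i) (muA i).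
have re i := revealed_entropy_bound (q0 i) (q1 i) p0.
have lnM_ge0 : 0 <= ln (Num.max 1 ratio) by exact: ln_ge0.
(* Row contributions in the chain ln perm A <= sum t <= sum u <= ln bound. Equality of the ends
   forces t i = u i in every row. *)
pose t i := revealed_entropy (marginal mu i) + \sum_j marginal mu i j * ln (A i j).
pose u i := ln (lpnorm p (row i A)) + ln (Num.max 1 ratio) / n%:R.
have tu i : t i <= u i.
  by have [_ h _] := lp i; have [h' _] := re i; rewrite /t /u; rewrite -/ratio in h'; lra.
have lp_gt0 i : 0 < lpnorm p (row i A) by have [] := lp i.
have bound0 : 0 < bound by rewrite mulr_gt0 // prodr_gt0.
have ub : \sum_i u i <= ln bound.
  rewrite /bound lnM ?posrE ?prodr_gt0 // ln_prod // /u big_split /= addrC lerD2r.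
  rewrite sumr_const card_ord; case: (n) => [|k]; first by rewrite mulr0n.
  by rewrite -[_ *+ _]mulr_natr divfK // pnatr_eq0.
have le : permanent A <= bound.
  rewrite -ler_ln ?posrE //; apply: le_trans lnP _; apply: le_trans ub.
  by apply: ler_sum => i _; exact: tu.
split=> // _ excl eq.
have tuE i : t i = u i.
  apply/eqP; rewrite eq_le tu /= -subr_le0.
  have /eqP : \sum_i (u i - t i) = 0.
    apply/eqP; rewrite eq_le sumr_ge0 ?andbT => [|j _]; last by rewrite subr_ge0.
    by rewrite sumrB subr_le0 (le_trans ub) // -eq.
  rewrite psumr_eq0 => [/allP/(_ i (mem_index_enum _))/eqP -> //|j _].
  by rewrite subr_ge0.
have row_eq i : (forall j, marginal mu i j = A i j `^ p / \sum_k A i k `^ p) /\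
    ((ratio <= 1 /\ exists j, marginal mu i j = 1) \/
     (1 <= ratio /\ forall j, marginal mu i j = n%:R^-1)).
  have [_ h eqA] := lp i; have [h' eqr] := re i; have := tuE i.
  rewrite -/ratio in h' eqr; rewrite /t /u => e; split; first by apply: eqA; lra.
  by apply: eqr => //; lra.
have col j : \sum_i marginal mu i j = 1 by rewrite sum_marginal_col.
have [/existsP[i0 /existsP[j0 /eqP q1_0]]|] :=
    boolP [exists i, [exists j, marginal mu i j == 1]].
  (* Columns of marginals sum to 1, so a column given mass 1 by one row receives none from
     another. *)
  have excl_col i j i' : marginal mu i j = 1 -> marginal mu i' j != 0 -> i' = i.
    move=> ij i'j; apply/eqP; apply: contraT => ii'.
    have := col j; rewrite (bigD1 i) //= (bigD1 i') //= ij => /eqP.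
    rewrite -subr_eq0 addrAC subrr add0r paddr_eq0 ?sumr_ge0 // => /andP[/eqP z _].
    by rewrite z eqxx in i'j.
  have n0 : (0 < n)%N by apply: leq_ltn_trans (ltn_ord i0).
  (* A uniform row would put mass 1/n on column j0, hence be row i0; so every row is Dirac. *)
  have det i : exists j, marginal mu i j = 1.
    have [_ [[_ //]|[_ unif]]] := row_eq i.
    exists j0; rewrite (excl_col i0 j0 i) // unif invr_eq0 pnatr_eq0 -lt0n //.
  have r1 : ratio <= 1.
    have [_ [[]//|[_ unif]]] := row_eq i0.
    have nE : n%:R = 1 :> R by apply: invr_inj; rewrite -(unif j0) q1_0 invr1.
    have {}nE : n = 1%N by apply/eqP; rewrite -(eqr_nat R) nE.
    by rewrite /ratio nE powR1 divr1.
  left; split=> //.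
  pose f i := projT1 (cid (det i)); have fE i : marginal mu i (f i) = 1 := projT2 (cid (det i)).
  have inj_f : injective f.
    by move=> i i' e; apply: excl_col (fE i') _; rewrite -e fE oner_neq0.
  exists (perm inj_f), (fun i => A i (f i)); split=> i.
    by apply: muA; rewrite fE.
  apply/rowP => j; rewrite !mxE permE.
  have [<-|fj] := eqVneq; first by rewrite mulr1.
  rewrite mulr0; have [eqA _] := row_eq i.
  have : marginal mu i j = 0.
    have := q1 i; rewrite (bigD1 (f i)) //= fE (bigD1 j) 1?eq_sym //= => /eqP.
    rewrite -subr_eq0 addrAC subrr add0r paddr_eq0 ?sumr_ge0 // => /andP[/eqP //].
  rewrite eqA => /eqP; rewrite mulf_eq0 powR_eq0 => /orP[/andP[/eqP //]|].
  have := fE i; rewrite eqA => e /eqP z.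
  by move: e => /eqP; rewrite z mulr0 eq_sym oner_eq0.
rewrite negb_exists => /forallP nodet.
have unif i : 1 <= ratio /\ forall j, marginal mu i j = n%:R^-1.
  have [_ [[_ [j ij]]|//]] := row_eq i.
  by have := nodet i; rewrite negb_exists => /forallP/(_ j); rewrite ij eqxx.
(* A uniform law proportional to the p-th powers of the entries makes row i constant. *)
have A_const i j : 0 < A i j /\ A i j = A i i.
  have [eqA _] := row_eq i; have [_ qn] := unif i.
  have n0 : (0 < n)%N by apply: leq_ltn_trans (ltn_ord i).
  split; first by apply: muA; rewrite qn invr_gt0 ltr0n.
  apply: (powR_injective p0); rewrite ?nnegrE //.
  have := qn i; rewrite -(qn j) !eqA => /mulIf -> //.
  have := qn i; rewrite eqA => e; apply/eqP => z; move: e => /eqP.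
  by rewrite z mulr0 eq_sym invr_eq0 pnatr_eq0 gtn_eqF.
(* For n = 0 no row supplies 1 <= ratio, but ratio = 1 and the first family applies. *)
have [n0|n0] := posnP n.
  left; split; first by rewrite /ratio n0 mul0r powRr0 divr1.
  exists 1%g, (fun=> 1); split=> i; first exact: ltr01.
  by have := ltn_ord i; rewrite {2}n0.
right; split; first by have [] := unif (Ordinal n0).
exists 1%g, (fun i => A i i); split=> i; first by have [] := A_const i i.
by apply/rowP => j; rewrite !mxE mulr1; have [_ ->] := A_const i j.
Qed.
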